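(* Let $M$ be a $\mathbb{Z}^k$-graded $R$-module. Then $$ \bigcup_{i=1}^k \mathbb{C}_{B_i}(M)^* \;=\; \bigcup_{i_1,\dots,i_p} \mathbb{C}_{B_{i_1}+\cdots+B_{i_p}}(M)^* \;=\; \mathbb{C}_B(M)^*, $$ where the middle union runs over all $p\ge 1$ and all $1\le i_1<\cdots<i_p\le k$.
   Context: $S$ is an arbitrary commutative unitary ring, $k\ge 1$, $n_1,\dots,n_k\ge 1$, and $R=S[X_{i,j} : 1\le i\le k,\ 1\le j\le n_i]$ with its standard $\mathbb{Z}^k$-grading: elements of $S$ have degree $0$ and $\deg X_{i,j}=e_i$, the $i$-th canonical generator of $\mathbb{Z}^k$. $B_i$ is the ideal $(X_{i,1},\dots,X_{i,n_i})$ and $B=B_1\cap\cdots\cap B_k=B_1\cdots B_k$. Modules are not assumed finitely generated. For a finitely generated homogeneous ideal $I=(f_1,\dots,f_s)$ with $f_i$ homogeneous, $H^i_I(M)$ is the $i$-th cohomology of the Čech complex of $M$ with respect to $(f_1,\dots,f_s)$; it is $\mathbb{Z}^k$-graded. For a graded module $N$, $\operatorname{Supp}_{\mathbb{Z}^k}(N)=\{\gamma\in\mathbb{Z}^k : N_\gamma\ne 0\}$. $\mathbb{C}_I(M)=\bigcup_i \operatorname{Supp}_{\mathbb{Z}^k}(H^i_I(M))$. For $E\subseteq\mathbb{Z}^k$, $E^*=E-\mathbb{N}^k=\{e-\mu : e\in E,\ \mu\in\mathbb{N}^k\}$, with $\mathbb{N}=\mathbb{Z}_{\ge 0}$. *)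

(* Defs.v *)
From HB Require Import structures.
From mathcomp Require Import all_boot all_order all_algebra.
From mathcomp Require Import boolp classical_sets.
From mathcomp Require Import zify mpoly.

Set Implicit Arguments.
Unset Strict Implicit.
Unset Printing Implicit Defensive.

Import GRing.Theory.

Local Open Scope quotient_scope.
Local Open Scope ring_scope.
Local Open Scope classical_set_scope.

Section Localization.
Variables (R : comPzRingType) (M : lmodType R) (f : R).
Implicit Types u v w : M * nat.

(* The pair (m, a) stands for the fraction m / f ^ a. *)
Definition loc_rel u v : bool :=
  `[< exists c, f ^+ c *: (f ^+ v.2 *: u.1 - f ^+ u.2 *: v.1) = 0 >].

Lemma loc_relP u v :
  reflect (exists c, f ^+ (c + v.2) *: u.1 = f ^+ (c + u.2) *: v.1)
          (loc_rel u v).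
Proof.
apply: (iffP (asboolP _)) => -[c e]; exists c.
  by apply/subr0_eq; rewrite -e scalerBr !scalerA -!exprD.
by rewrite scalerBr !scalerA -!exprD e subrr.
Qed.

Lemma loc_rel_equiv : equiv_class_of loc_rel.
Proof.
split=> [u|u v|v u w].
- by apply/loc_relP; exists 0%N.
- by apply/loc_relP/loc_relP => -[c e]; exists c.
- move=> /loc_relP[c e1] /loc_relP[d e2]; apply/loc_relP.
  exists (c + d + v.2)%N.
  rewrite [X in f ^+ X *: u.1 = _](_ : _ = (d + w.2) + (c + v.2))%N; last by lia.
  rewrite exprD -scalerA e1 scalerA -exprD addnC exprD -scalerA e2.
  by rewrite scalerA -exprD; congr (f ^+ _ *: _); lia.
Qed.

Canonical loc_equiv := EquivRelPack loc_rel_equiv.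
Canonical loc_encModRel := defaultEncModRel loc_rel.

Definition loc := {eq_quot loc_rel}.
HB.instance Definition _ := Choice.on loc.
HB.instance Definition _ := EqQuotient.on loc.

Definition frac (m : M) (a : nat) : loc := \pi_loc (m, a).

Lemma fracP m a m' a' :
  frac m a = frac m' a' <->
  exists c, f ^+ c *: (f ^+ a' *: m - f ^+ a *: m') = 0.
Proof. by split=> [/eqmodP/asboolP|h]; last exact/eqmodP/asboolP. Qed.

Lemma frac_ind (P : loc -> Prop) : (forall m a, P (frac m a)) -> forall x, P x.
Proof. by move=> h x; rewrite -[x]reprK; case: (repr x) => m a; exact: h. Qed.

Lemma fracE m a m' a' :
  frac m a = frac m' a' <-> exists c, f ^+ (c + a') *: m = f ^+ (c + a) *: m'.
Proof. by split=> [/eqmodP/loc_relP|h]; last exact/eqmodP/loc_relP. Qed.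

Lemma repr_frac m a :
  exists c, f ^+ (c + a) *: (repr (frac m a)).1
            = f ^+ (c + (repr (frac m a)).2) *: m.
Proof. by apply/fracE; rewrite /frac -surjective_pairing reprK. Qed.

Definition loc_zero : loc := frac 0 0.
Definition loc_opp (x : loc) : loc := frac (- (repr x).1) (repr x).2.
Definition loc_add (x y : loc) : loc :=
  frac (f ^+ (repr y).2 *: (repr x).1 + f ^+ (repr x).2 *: (repr y).1)
       ((repr x).2 + (repr y).2).

Lemma loc_oppE m a : loc_opp (frac m a) = frac (- m) a.
Proof.
by apply/fracE; have [c e] := repr_frac m a; exists c; rewrite !scalerN e.
Qed.

Lemma loc_addE m a m' a' :
  loc_add (frac m a) (frac m' a') = frac (f ^+ a' *: m + f ^+ a *: m') (a + a').
Proof.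
rewrite /loc_add; have [c] := repr_frac m a; have [c'] := repr_frac m' a'.
set u := repr _; set v := repr _ => e' e; apply/fracE; exists (c + c')%N.
rewrite !scalerDr !scalerA -!exprD.
rewrite [X in f ^+ X *: v.1](_ : _ = (c' + a' + u.2) + (c + a))%N; last by lia.
rewrite [X in f ^+ X *: u.1](_ : _ = (c + a + v.2) + (c' + a'))%N; last by lia.
rewrite [in X in X + _]exprD [in X in _ + X]exprD -!scalerA e e' !scalerA -!exprD.
by congr (f ^+ _ *: _ + f ^+ _ *: _); lia.
Qed.

Lemma loc_addA : associative loc_add.
Proof.
elim/frac_ind=> m a; elim/frac_ind=> m' a'; elim/frac_ind=> m'' a''.
rewrite !loc_addE; apply/fracE; exists 0%N; rewrite !scalerDr !scalerA -!exprD addrA.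
by congr (f ^+ _ *: _ + f ^+ _ *: _ + f ^+ _ *: _); lia.
Qed.

Lemma loc_addC : commutative loc_add.
Proof.
by elim/frac_ind=> m a; elim/frac_ind=> m' a'; rewrite !loc_addE addrC addnC.
Qed.

Lemma loc_add0 : left_id loc_zero loc_add.
Proof. by elim/frac_ind=> m a; rewrite loc_addE scaler0 add0r scale1r. Qed.

Lemma loc_addN : left_inverse loc_zero loc_opp loc_add.
Proof.
elim/frac_ind=> m a; rewrite loc_oppE loc_addE scalerN addNr.
by apply/fracE; exists 0%N; rewrite !scaler0.
Qed.

HB.instance Definition _ :=
  GRing.isZmodule.Build loc loc_addA loc_addC loc_add0 loc_addN.

Lemma fracD m a m' a' :
  frac m a + frac m' a' = frac (f ^+ a' *: m + f ^+ a *: m') (a + a').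
Proof. exact: loc_addE. Qed.

Lemma fracN m a : - frac m a = frac (- m) a.
Proof. exact: loc_oppE. Qed.

Lemma frac0 a : frac 0 a = 0.
Proof. by apply/fracE; exists 0%N; rewrite !scaler0. Qed.

Lemma fracB m m' a : frac m a - frac m' a = frac (m - m') a.
Proof.
rewrite fracN fracD; apply/fracE; exists 0%N.
by rewrite -scalerDr scalerA -exprD !add0n.
Qed.

End Localization.

Arguments frac {R M} f m a.

(* The canonical map M_f -> M_f', m / f ^ a |-> (g ^ a m) / f' ^ a; it is well
   defined when f' = g * f, see [loc_mapE]. *)
Definition loc_map (R : comPzRingType) (M : lmodType R) (f f' g : R)
    (x : loc M f) : loc M f' :=
  frac f' (g ^+ (repr x).2 *: (repr x).1) (repr x).2.

Section LocMap.
Variables (R : comPzRingType) (M : lmodType R) (f f' g : R).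
Hypothesis f'E : f' = g * f.

Let f'XE x y (v : M) : f' ^+ x *: (g ^+ y *: v) = g ^+ (x + y) *: (f ^+ x *: v).
Proof. by rewrite f'E exprMn !scalerA mulrAC -exprD. Qed.

Lemma loc_mapE (m : M) a : loc_map f' g (frac f m a) = frac f' (g ^+ a *: m) a.
Proof.
rewrite /loc_map; have [c] := repr_frac f m a; set u := repr _ => e.
by apply/fracE; exists c; rewrite !f'XE e; congr (g ^+ _ *: _); lia.
Qed.

Lemma loc_mapB (x y : loc M f) :
  loc_map f' g (x - y) = loc_map f' g x - loc_map f' g y.
Proof.
move: x y; elim/frac_ind=> m b; elim/frac_ind=> m' a.
rewrite fracN fracD !loc_mapE fracN fracD -scalerN !f'XE [(b + a)%N]addnC.
by rewrite scalerDr [in X in _ + X]addnC addnC.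
Qed.

End LocMap.

Section Cech.
Variables (R : comPzRingType) (M : lmodType R) (s : nat) (f : 'I_s -> R).
Implicit Types (J : {set 'I_s}) (p : nat).

(* All degrees of the Cech complex at once: the component at J, with
   |J| = p, lives in cohomological degree p. *)
Definition cochain : Type :=
  {dffun forall J : {set 'I_s}, loc M (\prod_(j in J) f j)}.
HB.instance Definition _ := Choice.on cochain.

Definition cochain_zero : cochain := [ffun J => 0].
Definition cochain_opp (c : cochain) : cochain := [ffun J => - c J].
Definition cochain_add (b c : cochain) : cochain := [ffun J => b J + c J].

Fact cochain_addA : associative cochain_add.
Proof. by move=> a b c; apply/ffunP=> J; rewrite !ffunE addrA. Qed.
Fact cochain_addC : commutative cochain_add.
Proof. by move=> a b; apply/ffunP=> J; rewrite !ffunE addrC. Qed.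
Fact cochain_add0 : left_id cochain_zero cochain_add.
Proof. by move=> a; apply/ffunP=> J; rewrite !ffunE add0r. Qed.
Fact cochain_addN : left_inverse cochain_zero cochain_opp cochain_add.
Proof. by move=> a; apply/ffunP=> J; rewrite !ffunE addNr. Qed.

HB.instance Definition _ := GRing.isZmodule.Build cochain
  cochain_addA cochain_addC cochain_add0 cochain_addN.

Definition cech_diff (c : cochain) : cochain :=
  [ffun J : {set 'I_s} => \sum_(i in J)
     loc_map (\prod_(j in J) f j) (f i) (c (J :\ i)%SET)
       *~ (-1) ^+ #|[pred j in J | (j < i)%N]|].

Definition in_degree p : {pred cochain} :=
  fun c => [forall J : {set 'I_s}, (#|J| != p) ==> (c J == 0)].

Lemma in_degreeP p (c : cochain) :
  reflect (forall J, #|J| != p -> c J = 0) (c \in in_degree p).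
Proof.
apply: (iffP forallP) => h J; first by move=> nJ; have /implyP/(_ nJ)/eqP := h J.
by apply/implyP=> nJ; rewrite h.
Qed.

Lemma cochainB (b c : cochain) J : (b - c) J = b J - c J.
Proof. by rewrite !ffunE. Qed.

Lemma cochain0 J : (0 : cochain) J = 0.
Proof. by rewrite !ffunE. Qed.

Lemma cech_diffB : zmod_morphism cech_diff.
Proof.
move=> b c; apply/ffunP=> J; rewrite cochainB !ffunE -sumrB.
apply: eq_bigr => i iJ; rewrite cochainB (@loc_mapB _ _ _ _ (f i)) ?mulrzBl //.
rewrite (bigD1 i iJ) /=; congr (_ * _).
by apply: eq_bigl => j; rewrite !inE andbC.
Qed.

HB.instance Definition _ :=
  GRing.isZmodMorphism.Build cochain cochain cech_diff cech_diffB.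

Fact in_degree_closed p : zmod_closed (in_degree p).
Proof.
split=> [|b c /in_degreeP hb /in_degreeP hc]; apply/in_degreeP=> J nJ.
  by rewrite cochain0.
by rewrite cochainB hb ?hc ?subr0.
Qed.
HB.instance Definition _ p :=
  GRing.isZmodClosed.Build cochain (in_degree p) (in_degree_closed p).

Definition is_cocycle p : {pred cochain} :=
  fun c => (c \in in_degree p) && (cech_diff c == 0).

Fact is_cocycle_closed p : zmod_closed (is_cocycle p).
Proof.
split=> [|b c /andP[hb /eqP db] /andP[hc /eqP dc]]; apply/andP; split.
- exact: rpred0.
- by rewrite raddf0.
- exact: rpredB.
- by rewrite raddfB /= db dc subr0.
Qed.
HB.instance Definition _ p :=
  GRing.isZmodClosed.Build cochain (is_cocycle p) (is_cocycle_closed p).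

Record cocycle p := Cocycle { cocycle_val :> cochain; _ : cocycle_val \in is_cocycle p }.
HB.instance Definition _ p := [isSub for @cocycle_val p].
HB.instance Definition _ p := [Choice of cocycle p by <:].
HB.instance Definition _ p := [SubChoice_isSubZmodule of cocycle p by <:].

(* For p = 0 this forces b = 0. *)
Definition coboundary p : {pred cocycle p} :=
  fun z => `[< exists b : cochain,
    (forall J, #|J|.+1 != p -> b J = 0) /\ \val z = cech_diff b >].

Fact coboundary_closed p : zmod_closed (@coboundary p).
Proof.
split=> [|x y /asboolP[b [hb eb]] /asboolP[c [hc ec]]]; apply/asboolP.
  by exists 0; split=> [J _|]; rewrite ?cochain0 ?raddf0.
exists (b - c); split=> [J nJ|]; first by rewrite cochainB hb ?hc ?subr0.
by rewrite !raddfB /= -eb -ec.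
Qed.
HB.instance Definition _ p :=
  GRing.isZmodClosed.Build (cocycle p) (@coboundary p) (@coboundary_closed p).

Definition cech_cohomology p : zmodType := Quotient.quot (@coboundary p).

End Cech.

Section Graded.
Variables (G : zmodType) (R : comPzRingType) (R_ : G -> set R).

Record grading (M : lmodType R) := Grading {
  gr_comp :> G -> set M;
  gr_comp0 : forall g, gr_comp g 0;
  gr_compB : forall g x y, gr_comp g x -> gr_comp g y -> gr_comp g (x - y);
  gr_compZ : forall d g r x, R_ d r -> gr_comp g x -> gr_comp (d + g) (r *: x);
  gr_sum : forall x, exists (t : seq G) (c : G -> M),
    (forall g, gr_comp g (c g)) /\ x = \sum_(g <- t) c g;
  gr_direct : forall (t : seq G) (c : G -> M), uniq t ->
    (forall g, gr_comp g (c g)) -> \sum_(g <- t) c g = 0 ->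
    forall g, g \in t -> c g = 0
}.

Record hfamily := HFamily {
  hf_size : nat;
  hf_fun :> 'I_hf_size -> R;
  _ : forall j, exists d, R_ d (hf_fun j)
}.

Variables (M : lmodType R) (M_ : grading M).

(* When f <> 0 its degree d is unique; when f = 0 the localization is 0. *)
Definition loc_comp (f : R) (g : G) : set (loc M f) :=
  [set x | exists m a d, [/\ R_ d f, M_ (g + d *+ a) m & x = frac f m a]].

Definition cohomology_comp (F : hfamily) p (g : G) :
    set (cech_cohomology M F p) :=
  [set x | exists z : cocycle M F p,
     (forall J, loc_comp g (cocycle_val z J)) /\ x = \pi z].

Definition cohomology_supp (F : hfamily) p : set G :=
  [set g | exists x, @cohomology_comp F p g x /\ x <> 0].

(* C_I(M), computed from the generators F of I. *)
Definition csupp (F : hfamily) : set G :=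
  [set g | exists p, cohomology_supp F p g].

End Graded.

Definition ideal_gen (R : comPzRingType) s (f : 'I_s -> R) : set R :=
  [set r | exists c : 'I_s -> R, r = \sum_(j < s) c j * f j].

Section MultigradedPolynomials.
Variables (S : comNzRingType) (k : nat) (n : 'I_k -> nat).

Definition var_index : finType := {i : 'I_k & 'I_(n i)}.

Definition var_rank (i : 'I_k) (j : 'I_(n i)) : 'I_#|var_index| :=
  enum_rank (existT (fun i => 'I_(n i)) i j : var_index).

Definition mring : comNzRingType := {mpoly S[#|var_index|]}.

Definition mvar (i : 'I_k) (j : 'I_(n i)) : mring := 'X_(var_rank j).

Definition Zk : zmodType := {ffun 'I_k -> int}.

Definition monom_mdeg (m : 'X_{1.. #|var_index|}) : Zk :=
  [ffun i => \sum_(j < n i) (m (var_rank j))%:Z].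

Definition mring_comp (d : Zk) : set mring :=
  [set r : mring | forall m, m \in msupp r -> monom_mdeg m = d].

Definition mgraded_module (M : lmodType mring) : Type := grading mring_comp M.
Definition mhfamily : Type := hfamily mring_comp.

Definition block_ideal (i : 'I_k) : set mring := ideal_gen (@mvar i).

Definition block_sum (P : {set 'I_k}) : set mring :=
  [set r | exists b : 'I_k -> mring,
     (forall i, i \in P -> block_ideal i (b i)) /\ r = \sum_(i in P) b i].

Definition block_cap : set mring := \bigcap_i block_ideal i.

End MultigradedPolynomials.

Arguments mgraded_module {S k n} M.
Arguments block_ideal S {k} n i.
Arguments block_sum S {k} n P.
Arguments block_cap S {k} n.

Definition star k (E : set (Zk k)) : set (Zk k) :=
  [set g | exists e (mu : {ffun 'I_k -> nat}),
     E e /\ g = e - [ffun i => (mu i)%:Z]].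

(* Main.v *)
Require Import Defs.
From mathcomp Require Import all_boot all_order all_algebra.
From mathcomp Require Import boolp classical_sets mpoly.
From mathcomp Require Import zify ring.

(* Fix [gamma]. By definition [gamma] lies outside the star of the support of the cohomology
   of [I] iff the Cech complex of [I] is exact in all degrees of [gamma + N^k]. All variables
   have degrees in N^k, so these degrees are stable under multiplication by homogeneous
   elements, and this exactness property of a family of homogeneous elements
   (a) persists when an element [f] is added, the new Cech complex being the cone of
       C -> C_f, where C_f is a colimit of copies of C in higher degrees;
   (b) persists when an element [f] of the ideal of the remaining ones is dropped, because
       then C_f is acyclic;
   (c) passes from the families [A, f] and [A, g] to the family [A, f g], because exactness
       for [A, f] means that [f] acts bijectively on the cohomology of [A].
   By (a) and (b) exactness for [I] implies exactness for every larger ideal, which gives all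
   the inclusions except that the star for [B] lies in the union of those for the [B_i]. For
   that one, [B] contains the products [f_1 ... f_k] with [f_i] a generator of [B_i]. By (c)
   such a product may be traded for each of its factors; and a choice of one factor in every
   product always contains all the generators of some [B_i]. *)

Import GRing.Theory.
Local Open Scope quotient_scope.
Local Open Scope ring_scope.

Set Implicit Arguments.
Unset Strict Implicit.
Unset Printing Implicit Defensive.

(** * Projections onto graded pieces *)

Section Projection.
Variables (G : zmodType) (R : comPzRingType) (R_ : G -> set R).
Variables (M : lmodType R) (M_ : grading R_ M).
Implicit Types (g : G) (x y : M) (c : G -> M).

Lemma gr_compN g x : M_ g x -> M_ g (- x).
Proof. by move=> hx; rewrite -sub0r; apply: gr_compB => //; exact: gr_comp0. Qed.

Lemma gr_compD g x y : M_ g x -> M_ g y -> M_ g (x + y).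
Proof. by move=> hx hy; rewrite -[y]opprK; apply: gr_compB => //; exact: gr_compN. Qed.

Lemma gr_comp_sign g x n : M_ g x -> M_ g ((-1) ^+ n *: x).
Proof.
by rewrite -signr_odd; case: (odd n) => hx; rewrite ?scaleN1r ?scale1r //; exact: gr_compN.
Qed.

Lemma gr_compX g e u x a : R_ e u -> M_ g x -> M_ (g + e *+ a) (u ^+ a *: x).
Proof.
move=> hu hx; elim: a => [|a IH]; first by rewrite addr0 scale1r.
by rewrite exprS -scalerA mulrS addrCA; exact: gr_compZ.
Qed.

Definition decomp x c := exists t : seq G, [/\ uniq t, forall g, M_ g (c g),
  forall g, g \notin t -> c g = 0 & x = \sum_(g <- t) c g].

Lemma decomp_wide (t t' : seq G) c : uniq t -> uniq t' -> {subset t <= t'} ->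
  (forall g, g \notin t -> c g = 0) -> \sum_(g <- t) c g = \sum_(g <- t') c g.
Proof.
move=> ut ut' tt' c0; rewrite [RHS](bigID (mem t)) /= [X in _ + X]big1 ?addr0; last exact: c0.
rewrite -[RHS]big_filter; apply: perm_big; apply: uniq_perm => // [|g].
  exact: filter_uniq.
by rewrite mem_filter /= andb_idr //; exact: tt'.
Qed.

(** On a common list of degrees the difference of the two decompositions sums to zero, so directness
    applies. *)
Lemma decomp_uniq x c c' : decomp x c -> decomp x c' -> c =1 c'.
Proof.
move=> [t [ut ct c0 xE]] [t' [ut' ct' c0' xE']] g.
pose w := undup (t ++ t').
have uw : uniq w by exact: undup_uniq.
have tw : {subset t <= w} by move=> z zt; rewrite mem_undup mem_cat zt.
have tw' : {subset t' <= w} by move=> z zt; rewrite mem_undup mem_cat zt orbT.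
have [gw|gw] := boolP (g \in w); last first.
  by rewrite c0 ?c0' //; apply: contra gw; [exact: tw'|exact: tw].
apply/subr0_eq; apply: (@gr_direct _ _ _ _ M_ w (fun g => c g - c' g)) => //.
  by move=> z; exact: gr_compB.
by rewrite sumrB -(decomp_wide ut uw) // -(decomp_wide ut' uw) // -xE -xE' subrr.
Qed.

Lemma decomp_exists x : exists c, decomp x c.
Proof.
have [t [c [ct ->]]] := gr_sum M_ x.
(* The list given by [gr_sum] may repeat a degree; the multiplicity is absorbed into the
   component. *)
exists (fun g => if g \in t then c g *+ count_mem g t else 0), (undup t); split.
- exact: undup_uniq.
- move=> g; case: ifP => _; last exact: gr_comp0.
  elim: (count_mem g t) => [|n IH]; first exact: gr_comp0.
  by rewrite mulrS; exact: gr_compD.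
- by move=> g; rewrite mem_undup => /negbTE ->.
- rewrite -big_undup_iterop_count big_seq_cond [RHS]big_seq_cond.
  apply: eq_bigr => g /andP[]; rewrite mem_undup => -> _.
  by [].
Qed.

Definition pr g x : M := sval (cid (decomp_exists x)) g.

Lemma prE x c g : decomp x c -> pr g x = c g.
Proof. by rewrite /pr; case: cid => /= c' h' h; exact: decomp_uniq h' h g. Qed.

Lemma pr_comp g x : M_ g (pr g x).
Proof. by rewrite /pr; case: cid => /= c' [t []]. Qed.

Lemma decomp_pr x : decomp x (pr ^~ x).
Proof. by rewrite /pr; case: cid. Qed.

Lemma pr_id g x : M_ g x -> pr g x = x.
Proof.
move=> gx; rewrite (@prE x (fun z => if z == g then x else 0)) ?eqxx //.
exists [:: g]; split=> // [z|z|].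
- by case: eqP => [->//|_]; exact: gr_comp0.
- by rewrite inE => /negbTE ->.
- by rewrite big_seq1 eqxx.
Qed.

Lemma prD g x y : pr g (x + y) = pr g x + pr g y.
Proof.
apply: (@prE _ (fun g => pr g x + pr g y)).
have [t [ut ct c0 xE]] := decomp_pr x; have [t' [ut' ct' c0' xE']] := decomp_pr y.
pose w := undup (t ++ t').
have uw : uniq w by exact: undup_uniq.
have tw : {subset t <= w} by move=> z zt; rewrite mem_undup mem_cat zt.
have tw' : {subset t' <= w} by move=> z zt; rewrite mem_undup mem_cat zt orbT.
exists w; split=> // [z|z zw|].
- by apply: gr_compD; exact: pr_comp.
- by rewrite c0 ?c0' ?addr0 //; apply: contra zw; [exact: tw'|exact: tw].
- by rewrite big_split /= -(decomp_wide ut uw) // -(decomp_wide ut' uw) // -xE -xE'.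
Qed.

Lemma prZ g e u x : R_ e u -> pr (e + g) (u *: x) = u *: pr g x.
Proof.
move=> hu; have [t [ut ct c0 xE]] := decomp_pr x.
rewrite (@prE _ (fun z => u *: pr (z - e) x)) ?[e + g]addrC ?addrK //.
exists [seq e + z | z <- t]; split=> [|z|z zt|].
- by rewrite map_inj_uniq //; exact: addrI.
- by rewrite -{1}[z](subrK e) addrC; apply: gr_compZ => //; exact: pr_comp.
- rewrite c0 ?scaler0 //; apply: contra zt => zt; apply/mapP; exists (z - e) => //.
  by rewrite addrC subrK.
- rewrite big_map {1}xE scaler_sumr; apply: eq_bigr => z _.
  by rewrite [e + z]addrC addrK.
Qed.

Lemma pr0 g : pr g 0 = 0.
Proof. by apply: pr_id; exact: gr_comp0. Qed.

Lemma pr_sum (J : Type) (s : seq J) (P : pred J) (F : J -> M) g :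
  pr g (\sum_(j <- s | P j) F j) = \sum_(j <- s | P j) pr g (F j).
Proof. by apply: (big_morph (pr g)); [exact: prD | exact: pr0]. Qed.

Lemma pr_sign g x n : pr g ((-1) ^+ n *: x) = (-1) ^+ n *: pr g x.
Proof.
rewrite -signr_odd; case: (odd n); rewrite ?scale1r // !scaleN1r.
by apply/eqP; rewrite -addr_eq0 -prD addNr pr0.
Qed.

Lemma prX g e u x a : R_ e u -> pr (g + e *+ a) (u ^+ a *: x) = u ^+ a *: pr g x.
Proof.
move=> hu; elim: a => [|a IH]; first by rewrite addr0 !scale1r.
by rewrite !exprS -!scalerA mulrS addrCA prZ // IH.
Qed.

End Projection.

(** * The Cech complex as a colimit of Koszul complexes *)

Section Koszul.
Variables (G : zmodType) (R : comPzRingType) (R_ : G -> set R).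
Hypothesis R_1 : R_ 0 1.
Hypothesis R_M : forall d e u v, R_ d u -> R_ e v -> R_ (d + e) (u * v).
Variables (M : lmodType R) (M_ : grading R_ M).
Variables (I : finType) (lt : rel I) (h : I -> R) (d : I -> G).
Hypothesis lt_irr : irreflexive lt.
Hypothesis lt_tot : forall i j, i != j -> lt i j = ~~ lt j i.
Hypothesis h_d : forall i, R_ (d i) (h i).
Implicit Types (i j : I) (J T : {set I}) (m x y b : {set I} -> M) (g : G) (u v : R).

(* The signs of the Cech differential only need [lt] to be a tournament, which makes it
   easy to merge index sets: transitivity is never used. *)
Definition cnt i J : nat := \sum_(j in J) lt j i.

(* The Koszul differential of the powers [h i ^+ a]. Identifying [m] with the Cech cochain
   [(m J / hp J ^+ a)_J], the Cech complex is the colimit over [a] of these Koszul complexes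
   along the transition maps [tr]; [exact_at T g] is exactness in degree [g] of the Cech complex of
   the subfamily [T], read off on this colimit. *)
Definition delta a m J : M :=
  \sum_(i in J) ((-1) ^+ cnt i J * h i ^+ a) *: m (J :\ i)%SET.

Definition hp J : R := \prod_(j in J) h j.
Definition dp J : G := \sum_(j in J) d j.

Definition tr N m J : M := hp J ^+ N *: m J.

Definition homog_on T a g m := forall J, J \subset T -> M_ (g + dp J *+ a) (m J).

Definition exact_at T g := forall a m, homog_on T a g m ->
  (forall J, J \subset T -> delta a m J = 0) ->
  exists N b, homog_on T (a + N) g b /\
    forall J, J \subset T -> tr N m J = delta (a + N) b J.

(* Exactness in degree [g] of the cone of C -> C_u, where C is the Cech complex of [T] and
   [u] has degree [e]; the pair [(x, y)] stands for [(x, y / u ^+ a)]. *)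
Definition cone_exact T u e g := forall a x y, homog_on T a g x -> homog_on T a (g + e *+ a) y ->
  (forall J, J \subset T -> delta a x J = 0) ->
  (forall J, J \subset T -> delta a y J = u ^+ a *: x J) ->
  exists N x' y', [/\ homog_on T (a + N) g x',
    forall J, J \subset T -> tr N x J = delta (a + N) x' J &
    forall J, J \subset T ->
      u ^+ N *: tr N y J = u ^+ (a + N) *: x' J - delta (a + N) y' J].

Lemma sign_sq n : (-1) ^+ n * (-1) ^+ n = 1 :> R.
Proof. by rewrite -exprD addnn -signr_odd odd_double. Qed.

(** Exactly one of [lt i j] and [lt j i] holds, and whichever it is adds one to the exponents on the
    left only. *)
Lemma sign_swap i j J : i \in J -> j \notin J ->
  (-1) ^+ cnt j J * (-1) ^+ cnt i (j |: J)%SET =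
  - ((-1) ^+ cnt i J * (-1) ^+ cnt j (J :\ i)%SET) :> R.
Proof.
move=> iJ jJ; have ij : i != j by apply: contraNneq jJ => <-.
rewrite /cnt (big_setU1 _ jJ) /= (big_setD1 i iJ) /= -!/(cnt _ _).
by rewrite (lt_tot ij) -!exprD; case: (lt j i) => /=; rewrite !exprD; ring.
Qed.

Lemma cntU1_id i J : i \notin J -> cnt i (i |: J)%SET = cnt i J.
Proof. by move=> iJ; rewrite /cnt big_setU1 //= lt_irr. Qed.

Lemma delta_ext T a m m' : (forall J, J \subset T -> m J = m' J) ->
  forall J, J \subset T -> delta a m J = delta a m' J.
Proof.
move=> e J JT; apply: eq_bigr => i iJ; rewrite e //.
by apply: fintype.subset_trans JT; exact: finset.subsetDl.
Qed.

Lemma deltaB a m m' J : delta a (fun J => m J - m' J) J = delta a m J - delta a m' J.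
Proof. by rewrite -sumrB; apply: eq_bigr => i _; rewrite scalerBr. Qed.

Lemma deltaD a m m' J : delta a (fun J => m J + m' J) J = delta a m J + delta a m' J.
Proof. by rewrite -big_split; apply: eq_bigr => i _; rewrite scalerDr. Qed.

Lemma deltaZ a u m J : delta a (fun J => u *: m J) J = u *: delta a m J.
Proof. by rewrite scaler_sumr; apply: eq_bigr => i _; rewrite !scalerA mulrC. Qed.

Lemma delta0 a J : delta a (fun=> 0) J = 0.
Proof. by rewrite /delta big1 // => i _; rewrite scaler0. Qed.

(** Since [hp J] is [h i] times the product over [J :\ i], the transition maps are chain maps. *)
Lemma delta_tr a N m J : delta (a + N) (tr N m) J = hp J ^+ N *: delta a m J.
Proof.
rewrite scaler_sumr; apply: eq_bigr => i iJ; rewrite /tr !scalerA /hp (big_setD1 i iJ) /=.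
by rewrite exprMn exprD; congr (_ *: _); ring.
Qed.

Lemma tr_tr N N' m J : tr N (tr N' m) J = tr (N + N') m J.
Proof. by rewrite /tr scalerA -exprD. Qed.

Lemma dp_setD1 i J : i \in J -> dp J = d i + dp (J :\ i)%SET.
Proof. by move=> iJ; rewrite /dp (big_setD1 i iJ). Qed.

Lemma R_hp J : R_ (dp J) (hp J).
Proof.
rewrite /dp /hp; elim/big_ind2: _ => // e u e' v; exact: R_M.
Qed.

Lemma homog_on_tr T a N g m : homog_on T a g m -> homog_on T (a + N) g (tr N m).
Proof.
by move=> hm J JT; rewrite mulrnDr addrA; apply: gr_compX; [exact: R_hp | exact: hm].
Qed.

Lemma homog_onZ T a g u e n m : R_ e u -> homog_on T a g m ->
  homog_on T a (g + e *+ n) (fun J => u ^+ n *: m J).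
Proof. by move=> hu hm J JT; rewrite addrAC; apply: gr_compX => //; exact: hm. Qed.

Lemma homog_onB T a g m m' :
  homog_on T a g m -> homog_on T a g m' -> homog_on T a g (fun J => m J - m' J).
Proof. by move=> hm hm' J JT; apply: gr_compB; [exact: hm | exact: hm']. Qed.

Definition prc a g m J := pr M_ (g + dp J *+ a) (m J).

Lemma homog_on_prc T a g m : homog_on T a g (prc a g m).
Proof. by move=> J _; exact: pr_comp. Qed.

Lemma delta_prc a g m J : delta a (prc a g m) J = prc a g (delta a m) J.
Proof.
rewrite /prc pr_sum; apply: eq_bigr => i iJ.
by rewrite -!scalerA pr_sign (dp_setD1 iJ) mulrnDl addrCA [d i *+ a + _]addrC (prX _ _ _ _ (h_d i)).
Qed.

(** Each [h i] is homogeneous, so projecting a primitive componentwise gives another one. Primitives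
    can thus be built without regard to degrees. *)
Lemma homog_on_primitive T a g m b : homog_on T a g m ->
  (forall J, J \subset T -> m J = delta a b J) ->
  exists b', homog_on T a g b' /\ forall J, J \subset T -> m J = delta a b' J.
Proof.
move=> hm mb; exists (prc a g b); split=> [|J JT]; first exact: homog_on_prc.
by rewrite delta_prc /prc -mb // pr_id //; exact: hm.
Qed.

(** * Splitting off one index: mapping cones *)

Definition slice i m J : M := (-1) ^+ cnt i J *: m (i |: J)%SET.

(** Sort the faces of [i |: J]: dropping [i] yields [h i ^+ a *: m J], and the other faces yield the
    differential of the slice, negated by [sign_swap]. *)
Lemma delta_cone i a m J : i \notin J ->
  (-1) ^+ cnt i J *: delta a m (i |: J)%SET = h i ^+ a *: m J - delta a (slice i m) J.
Proof.
move=> iJ; rewrite /delta big_setU1 //= cntU1_id // scalerDr scalerA.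
rewrite mulrA sign_sq mul1r setU1K //; congr (_ + _).
rewrite scaler_sumr -sumrN; apply: eq_bigr => j jJ.
have ij : i != j by apply: contraNneq iJ => ->.
rewrite /slice; have -> : ((i |: J) :\ j = i |: J :\ j)%SET.
  by apply/setP=> z; rewrite !inE; case: (eqVneq z j) => [->|]; rewrite // eq_sym (negbTE ij).
by rewrite !scalerA mulrA (sign_swap jJ iJ) -scaleNr; congr (_ *: _); ring.
Qed.

Lemma subset_setU1 i J T : J \subset T -> (i |: J \subset i |: T)%SET.
Proof. exact: finset.setUS. Qed.

Lemma notin_sub i J T : i \notin T -> J \subset T -> i \notin J.
Proof. by move=> iT /fintype.subsetP JT; apply: contra iT; exact: JT. Qed.

Lemma dp_setU1 i J : i \notin J -> dp (i |: J)%SET = d i + dp J.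
Proof. by move=> iJ; rewrite /dp big_setU1. Qed.

Lemma hp_setU1 i J : i \notin J -> hp (i |: J)%SET = h i * hp J.
Proof. by move=> iJ; rewrite /hp big_setU1. Qed.

Lemma homog_on_slice i T a g m : i \notin T -> homog_on (i |: T)%SET a g m ->
  homog_on T a (g + d i *+ a) (slice i m).
Proof.
move=> iT hm J JT; apply: gr_comp_sign; rewrite -addrA -mulrnDl.
by rewrite -dp_setU1 ?(notin_sub iT JT) //; apply: hm; exact: subset_setU1.
Qed.

Definition glue i x y J : M :=
  if i \in J then (-1) ^+ cnt i (J :\ i)%SET *: y (J :\ i)%SET else x J.

Lemma glue_out i x y T J : i \notin T -> J \subset T -> glue i x y J = x J.
Proof. by move=> iT JT; rewrite /glue (negbTE (notin_sub iT JT)). Qed.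

Lemma slice_glue i x y T J : i \notin T -> J \subset T -> slice i (glue i x y) J = y J.
Proof.
move=> iT JT; rewrite /slice /glue finset.setU11 setU1K ?(notin_sub iT JT) //.
by rewrite scalerA sign_sq scale1r.
Qed.

Lemma subset_U1_case i T J : i \notin T -> (J \subset i |: T)%SET ->
  J \subset T \/ exists2 J' : {set I}, J' \subset T & J = (i |: J')%SET.
Proof.
move=> iT JT; have [iJ|iJ] := boolP (i \in J); [right|left].
  by exists (J :\ i)%SET; rewrite ?finset.setD1K // finset.subDset.
apply/fintype.subsetP=> z zJ; have := fintype.subsetP JT z zJ.
by rewrite !inE; case: eqP => // zi; rewrite zi (negbTE iJ) in zJ.
Qed.

Lemma sign_inj n (x y : M) : (-1) ^+ n *: x = (-1) ^+ n *: y -> x = y.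
Proof.
move=> e; have := congr1 (fun z => (-1) ^+ n *: z) e.
by rewrite !scalerA sign_sq !scale1r.
Qed.

(** A cochain on [i |: T] amounts to its restriction to [T] together with its slice at [i];
    [delta_cone] translates the cocycle and coboundary equations. *)
Lemma exact_cone i T g : i \notin T -> exact_at (i |: T)%SET g <-> cone_exact T (h i) (d i) g.
Proof.
move=> iT; split=> [ex a x y hx hy dx dy | cone a m hm dm].
  have nJ J : J \subset T -> i \notin J by exact: notin_sub.
  have [J JT|J JT|N [b [hb eb]]] := ex a (glue i x y).
  - have [{}JT|[J' JT' ->]] := subset_U1_case iT JT.
      by rewrite (glue_out _ _ iT JT); exact: hx.
    rewrite /glue finset.setU11 setU1K ?nJ //; apply: gr_comp_sign.
    by rewrite dp_setU1 ?nJ // mulrnDl addrA; exact: hy.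
  - have [{}JT|[J' JT' ->]] := subset_U1_case iT JT.
      by rewrite -(dx J JT); apply: (@delta_ext T) => // K KT; exact: glue_out KT.
    apply: (@sign_inj (cnt i J')); rewrite scaler0 delta_cone ?nJ //.
    rewrite (glue_out _ _ iT JT') -dy //; apply/eqP; rewrite subr_eq0; apply/eqP.
    by apply: (@delta_ext T) => // K KT; rewrite (slice_glue _ _ iT KT).
  exists N, b, (slice i b); split=> [J JT|J JT|J JT].
  - by apply: hb; apply: fintype.subset_trans JT _; exact: finset.subsetUr.
  - rewrite -eb; last by apply: fintype.subset_trans JT _; exact: finset.subsetUr.
    by rewrite /tr (glue_out _ _ iT JT).
  - rewrite -delta_cone ?nJ // -eb ?subset_setU1 // /tr hp_setU1 ?nJ //.
    rewrite /glue finset.setU11 setU1K ?nJ // !scalerA exprMn; congr (_ *: _).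
    rewrite -[LHS]mul1r -{1}(sign_sq (cnt i J)); ring.
have nJ J : J \subset T -> i \notin J by exact: notin_sub.
have sT J : J \subset T -> (J \subset i |: T)%SET.
  by move=> JT; apply: fintype.subset_trans JT _; exact: finset.subsetUr.
have [J JT||J JT|J JT|N [x' [y' [_ ex' ey']]]] := cone a m (slice i m).
- by apply: hm; exact: sT.
- exact: homog_on_slice.
- by apply: dm; exact: sT.
- apply/esym/eqP; rewrite -subr_eq0 -delta_cone ?nJ // dm ?scaler0 //.
  exact: subset_setU1.
(* [cone_exact] says nothing about the degree of [y'], so the glued primitive is projected. *)
exists N; apply: (@homog_on_primitive _ _ _ _ (glue i x' y')); first exact: homog_on_tr.
move=> J JT; have [{}JT|[J' JT' ->]] := subset_U1_case iT JT.
  by rewrite ex' //; apply: (@delta_ext T) => // K KT; rewrite (glue_out _ _ iT KT).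
apply: (@sign_inj (cnt i J')); rewrite delta_cone ?nJ // (glue_out _ _ iT JT').
rewrite (@delta_ext T _ _ y') // => [|K KT]; last exact: slice_glue KT.
rewrite -ey' // /tr hp_setU1 ?nJ // /slice !scalerA exprMn; congr (_ *: _); ring.
Qed.

(** Exactness of [T] is used twice: in degree [g] for a primitive [b] of [x], then in degree
    [g + e *+ (a + N)] for the cocycle [y1] obtained by correcting [y] with [b]. *)
Lemma cone_of_exact T u e g : R_ e u -> (forall n, exact_at T (g + e *+ n)) -> cone_exact T u e g.
Proof.
move=> hu ex a x y hx hy dx dy.
have [||N [b [hb eb]]] := ex 0%N a x; [by rewrite addr0|by []|rewrite addr0 in hb].
pose y1 J := u ^+ N *: tr N y J - u ^+ (a + N) *: b J.
have hy1 : homog_on T (a + N) (g + e *+ (a + N)) y1.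
  apply: homog_onB; last exact: homog_onZ.
  rewrite mulrnDr addrA; apply: homog_onZ => //; exact: homog_on_tr.
have dy1 J : J \subset T -> delta (a + N) y1 J = 0.
  move=> JT; rewrite deltaB !deltaZ delta_tr dy // -eb // /tr !scalerA exprD.
  by apply/eqP; rewrite subr_eq0; apply/eqP; congr (_ *: _); ring.
have [N' [c [hc ec]]] := ex _ _ _ hy1 dy1.
exists (N + N')%N, (tr N' b), (fun J => (- u ^+ N') *: c J); rewrite addnA; split=> [|J JT|J JT].
- exact: homog_on_tr.
- by rewrite delta_tr -eb // -/(tr _ _ _) tr_tr addnC.
- rewrite deltaZ scaleNr opprK -ec // /tr /y1 /tr !scalerBr !scalerA.
  rewrite [in RHS]addrC -addrA; set p := _ *: b J; set q := _ *: b J.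
  have -> : p = q by rewrite /p /q [in RHS]exprD; congr (_ *: _); ring.
  by rewrite addNr addr0; congr (_ *: _); rewrite !exprD; ring.
Qed.

Lemma cone_1 T g : cone_exact T 1 0 g.
Proof.
move=> a x y hx; rewrite mul0rn addr0 => hy dx dy.
exists 0%N, y, (fun=> 0); rewrite addn0; split=> // J JT.
  by rewrite dy // /tr expr1n !expr0 !scale1r.
by rewrite delta0 subr0 /tr !expr1n expr0 !scale1r.
Qed.

(* The cone of [u] is exact iff [u] acts bijectively on cohomology, and bijections compose. *)
Lemma cone_mul T u v e f g : R_ e u -> R_ f v ->
  (forall n, cone_exact T u e (g + f *+ n)) -> cone_exact T v f g -> cone_exact T (u * v) (e + f) g.
Proof.
move=> hu hv cu cv a x y hx hy dx dy.
(* As [(u * v) ^+ a] splits, [(v ^+ a *: x, y)] is a cocycle of the cone of [u]; its exactness gives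
   a primitive [x1] of [v ^+ a *: x] up to transition. *)
have [||J JT|J JT|N [x1 [y1 [hx1 ex1 ey1]]]] := cu a a (fun J => v ^+ a *: x J) y.
- exact: homog_onZ.
- by rewrite -addrA -mulrnDl [f + e]addrC.
- by rewrite deltaZ dx // scaler0.
- by rewrite dy // scalerA exprMn.
(* Hence [(x, x1)], raised to exponent [a + N], is a cocycle of the cone of [v]. *)
have [|||J JT|N' [x3 [y3 [hx3 ex3 ey3]]]] := cv (a + N)%N (tr N x) (fun J => v ^+ N *: x1 J).
- exact: homog_on_tr.
- by rewrite mulrnDr addrA; exact: homog_onZ.
- by move=> J JT; rewrite delta_tr dx // scaler0.
- by rewrite deltaZ -ex1 // /tr !scalerA exprD; congr (_ *: _); ring.
exists (N + N')%N, x3,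
  (fun J => u ^+ (a + N + N') *: y3 J + (u ^+ N' * v ^+ (N + N')) *: tr N' y1 J).
rewrite addnA; split=> // J JT; first by rewrite -ex3 // tr_tr addnC.
rewrite deltaD !deltaZ delta_tr.
have -> : (u * v) ^+ (N + N') *: tr (N + N') y J
    = (u ^+ N' * v ^+ (N + N') * hp J ^+ N') *: (u ^+ N *: tr N y J).
  by rewrite /tr !scalerA !exprMn !exprD; congr (_ *: _); ring.
rewrite ey1 // scalerBr; set z := delta _ y1 J; rewrite opprD addrA; congr (_ - _).
  have -> : (u ^+ N' * v ^+ (N + N') * hp J ^+ N') *: (u ^+ (a + N) *: x1 J)
      = u ^+ (a + N + N') *: (v ^+ N' *: tr N' (fun J => v ^+ N *: x1 J) J).
    by rewrite /tr !scalerA !exprD; congr (_ *: _); ring.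
  by rewrite ey3 // scalerBr scalerA exprMn.
by rewrite scalerA.
Qed.

(** * Dropping an element of the ideal of the others *)

Lemma ideal_power (T : {set I}) (c : I -> R) a : exists L (c' : I -> R),
  (\sum_(j in T) c j * h j) ^+ L = \sum_(j in T) c' j * h j ^+ a.
Proof.
pose Z v := exists c' : I -> R, v = \sum_(j in T) c' j * h j ^+ a.
have Z0 : Z 0 by exists (fun=> 0); rewrite big1 // => j _; rewrite mul0r.
have ZD v w : Z v -> Z w -> Z (v + w).
  move=> [p ->] [q ->]; exists (fun j => p j + q j).
  by rewrite -big_split; apply: eq_bigr => j _; rewrite mulrDl.
have ZM r v : Z v -> Z (r * v).
  move=> [p ->]; exists (fun j => r * p j).
  by rewrite mulr_sumr; apply: eq_bigr => j _; rewrite mulrA.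
suff [L ZL] : exists L, Z ((\sum_(j in T) c j * h j) ^+ L) by exists L.
elim/big_ind: _ => [|v w [p Zp] [q Zq]|j jT].
- by exists 1%N; rewrite expr1.
(* In total degree [p + q] every binomial term contains [v ^+ p] or [w ^+ q]. *)
- exists (p + q)%N; rewrite exprDn.
  elim/big_ind: _ => // i _; rewrite -mulr_natr mulrC; apply: (ZM).
  have [iq|qi] := ltnP i q.
    rewrite (_ : p + q - i = (q - i) + p)%N; last by lia.
    by rewrite exprD mulrAC; apply: ZM.
  by rewrite -(subnK qi) [w ^+ _]exprD mulrA; apply: ZM.
- exists a, (fun i => if i == j then c j ^+ a else 0).
  rewrite (bigD1 j jT) /= eqxx big1 ?addr0 ?exprMn // => i /andP[_ /negbTE ->].
  by rewrite mul0r.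
Qed.

Definition homotopy j x J : M := if j \in J then 0 else slice j x J.

(** This is the classical null-homotopy of multiplication by [h j ^+ a] on the Koszul complex,
    evaluated on a cocycle. If [j] is in [J], only the face without [j] contributes; otherwise
    [delta_cone] applies. *)
Lemma delta_homotopy T a j x J : j \in T ->
  (forall J, J \subset T -> delta a x J = 0) -> J \subset T ->
  delta a (homotopy j x) J = h j ^+ a *: x J.
Proof.
move=> jT dx JT; have [jJ|jJ] := boolP (j \in J); last first.
  rewrite (@delta_ext J _ _ (slice j x)) // => [|K KJ].
    apply/esym/eqP; rewrite -subr_eq0 -delta_cone // dx ?scaler0 //.
    by rewrite finset.subUset finset.sub1set jT.
  by rewrite /homotopy (negbTE (notin_sub jJ KJ)).
rewrite /delta (bigD1 j jJ) /= big1 ?addr0 => [|i /andP[iJ ij]]; last first.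
  by rewrite /homotopy !inE eq_sym ij jJ scaler0.
rewrite /homotopy finset.setD11 /slice finset.setD1K // scalerA.
rewrite -{1}(finset.setD1K jJ) cntU1_id ?finset.setD11 // mulrAC sign_sq mul1r.
by [].
Qed.

(** A power of [h i] kills the class of [x], by the homotopies and [ideal_power]. So [x] extends to
    a cocycle of the cone of [h i], whose exactness makes [x] a coboundary up to transition. *)
Lemma exact_remove T i g : i \notin T -> (exists c : I -> R, h i = \sum_(j in T) c j * h j) ->
  exact_at (i |: T)%SET g -> exact_at T g.
Proof.
move=> iT [c hiE] /(exact_cone _ iT) cone a x hx dx.
have [L [c' e]] := ideal_power T c a; rewrite -hiE in e.
pose s J := \sum_(j in T) c' j *: homotopy j x J.
have ds J : J \subset T -> delta a s J = h i ^+ L *: x J.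
  move=> JT; have -> : delta a s J = \sum_(j in T) c' j *: delta a (homotopy j x) J.
    transitivity (\sum_(j in T) delta a (fun J => c' j *: homotopy j x J) J).
      by rewrite exchange_big; apply: eq_bigr => k _; rewrite scaler_sumr.
    by apply: eq_bigr => j _; rewrite deltaZ.
  rewrite e scaler_suml; apply: eq_bigr => j jT.
  by rewrite (delta_homotopy jT dx JT) scalerA.
have aL : (L <= a + L)%N by exact: leq_addl.
(* The cone equation wants [h i] raised to the Koszul exponent itself; passing from [a] to [a + L]
   leaves room for the factor [h i ^+ L] provided by [s]. *)
have [||y [hy ey]] := @homog_on_primitive T (a + L) (g + d i *+ (a + L))
    (fun J => h i ^+ (a + L) *: tr L x J) (tr L (fun J => h i ^+ a *: s J)).
- exact/homog_onZ/homog_on_tr.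
- move=> J JT; rewrite delta_tr deltaZ ds // /tr !scalerA exprD; congr (_ *: _); ring.
have [|J JT|J JT|N [x' [_ [hx' ex' _]]]] := cone (a + L)%N (tr L x) y _ hy.
- exact: homog_on_tr.
- by rewrite delta_tr dx // scaler0.
- by rewrite -ey.
exists (L + N)%N, x'; rewrite addnA; split=> // J JT.
by rewrite -ex' // tr_tr addnC.
Qed.

(** * Exactness throughout a stable set of degrees *)

Variable D : G -> Prop.
Hypothesis D_d : forall g i, D g -> D (g + d i).
Let exact_on T := forall g, D g -> exact_at T g.

Lemma stable_mulrn e n g : (forall g, D g -> D (g + e)) -> D g -> D (g + e *+ n).
Proof.
by move=> De Dg; elim: n => [|n IH]; rewrite ?addr0 // mulrSr addrA; exact: De.
Qed.

Lemma exact_add T i : exact_on T -> exact_on (i |: T)%SET.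
Proof.
move=> ex g Dg; have [iT|iT] := boolP (i \in T).
  by rewrite (finset.setUidPr _) ?finset.sub1set //; exact: ex.
apply/(exact_cone _ iT)/cone_of_exact => // n; apply/ex/stable_mulrn => // g'; exact: D_d.
Qed.

Lemma exact_sub T T' : T \subset T' -> exact_on T -> exact_on T'.
Proof.
move=> TT' ex; rewrite -(finset.setUidPr TT') -(set_enum T') finset.setUC.
elim: (enum T') => [|i s IH].
  by rewrite (_ : [set x in [::]] = finset.set0) ?finset.set0U.
by rewrite set_cons -finset.setUA; exact: exact_add.
Qed.

(** First add all of [T'], then drop the elements of [T] one at a time. The remaining family always
    contains [T'], so its ideal contains the dropped element. *)
Lemma exact_ideal T T' :
  (forall i, i \in T -> exists c : I -> R, h i = \sum_(j in T') c j * h j) ->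
  exact_on T -> exact_on T'.
Proof.
move=> hT ex; have : exact_on ([set x in enum T] :|: T')%SET.
  by apply: exact_sub ex; rewrite set_enum finset.subsetUl.
have : {subset enum T <= T} by move=> i; rewrite mem_enum.
elim: (enum T) => [|i s IH] sT.
  by rewrite (_ : [set x in [::]] = finset.set0) ?finset.set0U.
rewrite set_cons -finset.setUA => exi; apply: IH => [j js|g Dg].
  by apply: sT; rewrite inE js orbT.
have [iT|iT] := boolP (i \in [set x in s] :|: T')%SET.
  by have := exi g Dg; rewrite (finset.setUidPr _) ?finset.sub1set.
apply: (exact_remove iT _ (exi g Dg)).
have [c ->] := hT i (sT i (mem_head i s)).
exists (fun j => if j \in T' then c j else 0).
rewrite [RHS](bigID (mem T')) /= [X in _ + X]big1 ?addr0; last first.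
  by move=> j /andP[_ /negbTE ->]; rewrite mul0r.
apply: eq_big => [j|j ->//]; rewrite !inE; by case: (j \in T'); rewrite ?orbT ?andbF.
Qed.

(** If [i] is already in [T] there is nothing to split off, and the cone is exact because [T] is. *)
Lemma cone_in T i : exact_on (i |: T)%SET -> forall g, D g -> cone_exact T (h i) (d i) g.
Proof.
move=> exi g Dg; have [iT|iT] := boolP (i \in T); last exact/(exact_cone _ iT)/exi.
rewrite (finset.setUidPr _) ?finset.sub1set // in exi.
by apply: cone_of_exact => // n; apply/exi/stable_mulrn => // g'; exact: D_d.
Qed.

Lemma exact_prod T i0 (K : finType) (q : K -> I) : i0 \notin T ->
  h i0 = \prod_(k : K) h (q k) -> d i0 = \sum_(k : K) d (q k) ->
  (forall k, exact_on (q k |: T)%SET) -> exact_on (i0 |: T)%SET.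
Proof.
move=> iT hE dE exq g Dg; apply/(exact_cone _ iT); rewrite hE dE.
(* [Q] carries the side conditions of [cone_mul] through the induction on the product; the empty
   product is [cone_1]. *)
pose Q u e := [/\ R_ e u, forall g, D g -> D (g + e) & forall g, D g -> cone_exact T u e g].
suff [_ _] : Q (\prod_(k : K) h (q k)) (\sum_(k : K) d (q k)) by exact.
elim/big_ind2: _ => [|u e v f [hu De cu] [hv Df cv]|k _].
- by split=> [//|g' | g' _]; rewrite ?addr0 //; exact: cone_1.
- split=> [|g' Dg'|g' Dg']; first exact: R_M.
    by rewrite addrA; apply/Df/De.
  by apply: cone_mul => // [n|]; [apply/cu/stable_mulrn | exact: cv].
- by split=> // [g' Dg'|]; [exact: D_d | exact: cone_in].
Qed.

End Koszul.

(** * Invariance under injective reindexing *)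

Section Transfer.
Variables (G : zmodType) (R : comPzRingType) (R_ : G -> set R).
Variables (M : lmodType R) (M_ : grading R_ M).
Variables (I I' : finType) (lt : rel I) (lt' : rel I').
Variables (h : I -> R) (h' : I' -> R) (d : I -> G) (d' : I' -> G) (phi : I -> I').
Hypothesis phi_inj : injective phi.
Hypothesis phi_lt : forall i j, lt' (phi i) (phi j) = lt i j.
Hypothesis phi_h : forall i, h' (phi i) = h i.
Hypothesis phi_d : forall i, d' (phi i) = d i.
Implicit Types (J T : {set I}) (m : {set I} -> M) (w : {set I'} -> M).

Lemma hp_imset J : hp h' (phi @: J) = hp h J.
Proof. by rewrite /hp big_imset /=; [apply: eq_bigr | move=> i j _ _ /phi_inj]. Qed.

Lemma dp_imset J : dp d' (phi @: J) = dp d J.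
Proof. by rewrite /dp big_imset /=; [apply: eq_bigr | move=> i j _ _ /phi_inj]. Qed.

Lemma delta_imset T a m w : (forall J, J \subset T -> m J = w (phi @: J)) ->
  forall J, J \subset T -> delta lt h a m J = delta lt' h' a w (phi @: J).
Proof.
move=> e J JT; rewrite /delta big_imset /=; last by move=> i j _ _ /phi_inj.
apply: eq_bigr => i iJ; rewrite phi_h; congr (_ ^+ _ * _ *: _).
  rewrite /cnt big_imset /=; last by move=> j k _ _ /phi_inj.
  by apply: eq_bigr => j _; rewrite phi_lt.
rewrite e ?(fintype.subset_trans (finset.subsetDl _ _)) //; congr w.
apply/finset.setP=> z; apply/imsetP/setD1P=> [[j /setD1P[ji jJ] ->]|[zi /imsetP[j jJ zE]]].
  by rewrite (inj_eq phi_inj) ji imset_f.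
by exists j => //; rewrite !inE jJ andbT; apply: contraNneq zi => <-; rewrite zE.
Qed.

Lemma preimset_imset J : phi @^-1: (phi @: J) = J.
Proof. by apply/finset.setP=> i; rewrite inE mem_imset. Qed.

Lemma subset_imset (J' : {set I'}) T : J' \subset phi @: T ->
  exists2 J : {set I}, J \subset T & J' = phi @: J.
Proof.
move=> J'T; exists (phi @^-1: J').
  apply/fintype.subsetP=> i; rewrite inE => /(fintype.subsetP J'T).
  by rewrite mem_imset.
apply/finset.setP=> z; apply/idP/imsetP=> [zJ|[i]]; last by rewrite inE => ? ->.
by have /imsetP[i iT zE] := fintype.subsetP J'T z zJ; exists i; rewrite // inE -zE.
Qed.

(** Both sides only see index sets inside [T] or its image, and there image and preimage are
    mutually inverse. *)
Lemma exact_transfer T g : exact_at M_ lt h d T g <-> exact_at M_ lt' h' d' (phi @: T) g.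
Proof.
split=> ex a m hm dm.
- pose m1 J := m (phi @: J).
  have [J JT|J JT|N [b [hb eb]]] := ex a m1.
  + by rewrite -dp_imset; apply: hm; exact: imsetS.
  + by rewrite (@delta_imset T _ _ m) // dm // imsetS.
  exists N, (fun J' : {set I'} => b (phi @^-1: J')); split=> J' /subset_imset[J JT ->].
    by rewrite dp_imset preimset_imset; exact: hb.
  rewrite /tr hp_imset -/(m1 J) -/(tr h N m1 J) eb //.
  by apply: (@delta_imset T) => // K _; rewrite preimset_imset.
- pose m1 (J' : {set I'}) := m (phi @^-1: J').
  have [J' /subset_imset[J JT ->]|J' /subset_imset[J JT ->]|N [b [hb eb]]] := ex a m1.
  + by rewrite dp_imset /m1 preimset_imset; exact: hm.
  + rewrite -(@delta_imset T _ m) ?dm // => K _.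
    by rewrite /m1 preimset_imset.
  exists N, (fun J => b (phi @: J)); split=> J JT.
    by rewrite -dp_imset; apply: hb; exact: imsetS.
  rewrite (@delta_imset T _ _ b) // -eb ?imsetS //.
  by rewrite /tr hp_imset /m1 preimset_imset.
Qed.

End Transfer.

(** * Families of homogeneous elements *)

Definition tournament (I : eqType) (lt : rel I) :=
  irreflexive lt /\ forall i j, i != j -> lt i j = ~~ lt j i.

Lemma tournament_ltn n : tournament (fun i j : 'I_n => (i < j)%N).
Proof.
by split=> [i|i j ij]; rewrite ?ltnn // -leqNgt ltn_neqAle ij.
Qed.

Definition rank_rel (C : finType) : rel C := fun a b => (enum_rank a < enum_rank b)%N.
Arguments rank_rel : clear implicits.

Lemma tournament_rank C : tournament (rank_rel C).
Proof.
split=> [i|i j ij]; rewrite /rank_rel ?ltnn // -leqNgt ltn_neqAle.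
by rewrite (inj_eq val_inj) (inj_eq enum_rank_inj) ij.
Qed.

Definition sum_rel (A B : Type) (p : rel A) (q : rel B) : rel (A + B) :=
  fun s t => match s, t with
  | inl a, inl b => p a b
  | inr a, inr b => q a b
  | inl _, inr _ => true
  | inr _, inl _ => false
  end.

Lemma tournament_sum (A B : eqType) (p : rel A) (q : rel B) :
  tournament p -> tournament q -> tournament (sum_rel p q).
Proof.
move=> [p1 p2] [q1 q2]; split=> [[a|b]|[a|b] [a'|b']] //=.
  exact: p2.
exact: q2.
Qed.

Definition tag_rel (K : eqType) (A : K -> Type) (pK : rel K) (p : forall x, rel (A x)) :
    rel {x : K & A x} :=
  fun u v => if tag u == tag v then p _ (tagged u) (tagged_as u v) else pK (tag u) (tag v).

Lemma tournament_tag (K : eqType) (A : K -> eqType) (pK : rel K) (p : forall x, rel (A x)) :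
  tournament pK -> (forall x, tournament (p x)) ->
  tournament (tag_rel pK p : rel {x : K & A x}).
Proof.
move=> [q1 q2] hp; split=> [[x a]|[x a] [y b]]; rewrite /tag_rel /=.
  by rewrite eqxx tagged_asE; have [-> _] := hp x.
case: (eqVneq x y) => [xy|xy]; last by rewrite q2.
case: y / xy b => b; rewrite !tagged_asE => ab.
by have [_ ->] := hp x; rewrite ?tagged_asE //; apply: contraNneq ab => ->.
Qed.

Section Families.
Variables (G : zmodType) (R : comPzRingType) (R_ : G -> set R).
Hypothesis R_1 : R_ 0 1.
Hypothesis R_M : forall d e u v, R_ d u -> R_ e v -> R_ (d + e) (u * v).
Variables (M : lmodType R) (M_ : grading R_ M).
Variable D : G -> Prop.

Definition exact_on (I : finType) (lt : rel I) (h : I -> R) (d : I -> G) (T : {set I}) :=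
  forall g, D g -> exact_at M_ lt h d T g.

(** The two families are placed side by side in the disjoint union, so that [exact_ideal] compares
    two subfamilies of a single one. *)
Lemma exact_on_ideal_le (I I' : finType) (lt : rel I) (lt' : rel I')
    (h : I -> R) (h' : I' -> R) (d : I -> G) (d' : I' -> G) :
  tournament lt -> tournament lt' ->
  (forall i, R_ (d i) (h i)) -> (forall i, R_ (d' i) (h' i)) ->
  (forall g i, D g -> D (g + d i)) -> (forall g i, D g -> D (g + d' i)) ->
  (forall i, exists c : I' -> R, h i = \sum_j c j * h' j) ->
  exact_on lt h d [set: I] -> exact_on lt' h' d' [set: I'].
Proof.
move=> hlt hlt' hd hd' Dd Dd' hh' ex.
pose H (s : I + I') := match s with inl i => h i | inr i => h' i end.
pose E (s : I + I') := match s with inl i => d i | inr i => d' i end.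
have [LT1 LT2] := tournament_sum hlt hlt'.
suff : exact_on (sum_rel lt lt') H E (inr @: [set: I']).
  by move=> ex' g Dg; apply: (proj2 (@exact_transfer _ _ _ _ M_ _ _ lt' (sum_rel lt lt')
    h' H d' E inr _ _ _ _ _ _)) (ex' g Dg) => // ? ? [].
have : exact_on (sum_rel lt lt') H E (inl @: [set: I]).
  by move=> g Dg; apply: (proj1 (@exact_transfer _ _ _ _ M_ _ _ lt (sum_rel lt lt')
    h H d E inl _ _ _ _ _ _)) (ex g Dg) => // ? ? [].
apply: exact_ideal => //; [by case|by move=> g [i|i]; [exact: Dd|exact: Dd']|].
move=> _ /imsetP[i _ ->]; have [c hE] := hh' i.
exists (fun s => if s is inr j then c j else 0); rewrite /= hE big_imset /=.
  by apply: eq_bigl => j; rewrite inE.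
by move=> ? ? _ _ [].
Qed.

Variables (K : finType) (A : K -> finType) (lt : forall x, rel (A x)).
Variables (h : forall x, A x -> R) (d : forall x, A x -> G).
Hypothesis hlt : forall x, tournament (@lt x).
Hypothesis hd : forall x (a : A x), R_ (d a) (h a).
Hypothesis Dd : forall x (a : A x) g, D g -> D (g + d a).

Let C : finType := {dffun forall x, A x}.

Let prod_h (c : C) : R := \prod_x h (c x).
Let sum_d (c : C) : G := \sum_x d (c x).

(* Replace one by one each product by one of its factors, in all possible ways;
   a family consisting of one factor of every product contains all of [h x] for some [x]. *)
Lemma exact_on_products : (forall x, exact_on (@lt x) (@h x) (@d x) [set: A x]) ->
  exact_on (rank_rel C) prod_h sum_d [set: C].
Proof.
move=> ex.
pose U := ({x : K & A x} + C)%type.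
pose LT : rel U := sum_rel (tag_rel (rank_rel K) lt) (rank_rel C).
pose H (s : U) := match s with inl p => h (tagged p) | inr c => prod_h c end.
pose E (s : U) := match s with inl p => d (tagged p) | inr c => sum_d c end.
have [LT1 LT2] : tournament LT.
  apply: tournament_sum; last exact: tournament_rank.
  by apply: tournament_tag => //; exact: tournament_rank.
have HE s : R_ (E s) (H s).
  case: s => [p|c] //=; rewrite /prod_h /sum_d.
  by elim/big_ind2: _ => // e u f v; exact: R_M.
have DE g s : D g -> D (g + E s).
  case: s => [p|c] /=; first exact: Dd.
  rewrite /sum_d; elim/big_ind: _ g => [g|e f De Df g Dg|x _ g]; rewrite ?addr0 //; last exact: Dd.
  by rewrite addrA; apply/Df/De.
pose var (c : C) x : U := inl (Tagged A (c x)).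
(* [Q] holds the products not yet replaced and [T] the factors chosen so far; the goal is the case
   where [Q] is everything and [T] is empty. *)
suff main n (Q : {set C}) (T : {set U}) : #|Q| = n -> (forall c, inr c \notin T) ->
    (forall c, c \notin Q -> exists x, var c x \in T) -> exact_on LT H E (inr @: Q :|: T)%SET.
  move=> g Dg; apply: (proj2 (@exact_transfer _ _ _ _ M_ _ _ (rank_rel C) LT
    prod_h H sum_d E inr _ _ _ _ _ _)) => //.
    by move=> ? ? [].
  rewrite -[X in exact_at _ _ _ _ X]finset.setU0.
  apply: (main _ _ _ erefl) => // [c|c]; rewrite finset.inE //.
elim: n Q T => [|n IH] Q T Qn T0 TQ.
  have Q0 c : c \notin Q by rewrite (cards0_eq Qn) finset.inE.
  (* Otherwise each [A x] has an element missing from [T], and the tuple of these is a product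
     without a factor in [T]. *)
  have [x xT] : exists x, forall a : A x, (inl (Tagged A a) : U) \in T.
    apply: contrapT => /forallNP nx.
    have {}nx x : exists a : A x, (inl (Tagged A a) : U) \notin T.
      by have /existsNP[a /negP] := nx x; exists a.
    pose c : C := [ffun x => xchoose (nx x)].
    have [x] := TQ c (Q0 c); rewrite /var ffunE.
    by rewrite (negbTE (xchooseP (nx x))).
  have : exact_on LT H E ((fun a => inl (Tagged A a)) @: [set: A x]).
    move=> g Dg; apply: (proj1 (@exact_transfer _ _ _ _ M_ _ _ (@lt x) LT (@h x) H (@d x) E
      (fun a => inl (Tagged A a)) _ _ _ _ _ _)) (ex x g Dg) => //.
      by move=> a a' [] /eqP; rewrite eq_Tagged => /eqP.
    by move=> a a'; rewrite /LT /= /tag_rel /= eqxx tagged_asE.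
  apply: exact_sub => //; apply/fintype.subsetP=> _ /imsetP[a _ ->].
  by rewrite finset.inE xT orbT.
have [c0 c0Q] : exists c, c \in Q by apply/card_gt0P; rewrite Qn.
have Q'n : #|Q :\ c0|%SET = n by have := cardsD1 c0 Q; rewrite c0Q Qn => -[].
have : exact_on LT H E (inr c0 |: (inr @: (Q :\ c0) :|: T))%SET.
  apply: (@exact_prod _ _ _ R_1 R_M _ _ _ _ _ _ _ _ _ _ _ _ _ K (var c0)) => //.
    rewrite finset.inE negb_or T0 andbT; apply/imsetP=> -[c cQ [e]].
    by rewrite -e finset.setD11 in cQ.
  (* Trading [c0] for its factor at [x] shrinks [Q] and keeps the invariant. *)
  move=> x; have : exact_on LT H E (inr @: (Q :\ c0) :|: (var c0 x |: T))%SET.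
    apply: IH => // [c|c]; first by rewrite !finset.inE negb_or T0.
    rewrite !finset.inE negb_and negbK => /orP[/eqP ->|/TQ[y yT]].
      by exists x; rewrite !finset.inE eqxx.
    by exists y; rewrite !finset.inE yT orbT.
  by rewrite finset.setUCA.
by rewrite finset.setUA -imsetU1 finset.setD1K.
Qed.

End Families.

(** * Comparison with the Cech complex of fractions *)

Section Fractions.
Variables (R : comPzRingType) (M : lmodType R) (f : R).

Lemma frac_scale (m : M) a n : Defs.frac f (f ^+ n *: m) (a + n) = Defs.frac f m a.
Proof. by apply/fracE; exists 0%N; rewrite scalerA -exprD. Qed.

Lemma fracD_same (m m' : M) a : Defs.frac f (m + m') a = Defs.frac f m a + Defs.frac f m' a.
Proof. by rewrite -[m']opprK -fracB fracN opprK. Qed.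

Lemma frac_sum (J : Type) (s : seq J) (P : pred J) (F : J -> M) a :
  Defs.frac f (\sum_(j <- s | P j) F j) a = \sum_(j <- s | P j) Defs.frac f (F j) a.
Proof.
by apply: (big_morph (fun m => Defs.frac f m a)); [move=> m m'; exact: fracD_same | exact: frac0].
Qed.

Lemma frac_sign (m : M) a n : Defs.frac f m a *~ (-1) ^+ n = Defs.frac f ((-1) ^+ n *: m) a.
Proof.
rewrite -!(signr_odd _ n); case: (odd n); rewrite ?scale1r ?mulr1z //.
by rewrite scaleN1r -fracN mulrNz mulr1z.
Qed.

End Fractions.

Lemma quot_pi_eq0 (V : zmodType) (W : zmodClosed V) (v : V) :
  (\pi_(Quotient.quot W) v == 0) = (v \in W).
Proof. by rewrite -[v in RHS]subr0 Quotient.idealrBE; congr (_ == _); rewrite piE. Qed.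

Section CechKoszul.
Variables (G : zmodType) (R : comPzRingType) (R_ : G -> set R).
Hypothesis R_1 : R_ 0 1.
Hypothesis R_M : forall d e u v, R_ d u -> R_ e v -> R_ (d + e) (u * v).
Hypothesis R_uniq : forall d e u, R_ d u -> R_ e u -> u <> 0 -> d = e.
Variables (M : lmodType R) (M_ : grading R_ M) (s : nat) (f : 'I_s -> R) (d : 'I_s -> G).
Hypothesis f_d : forall j, R_ (d j) (f j).
Implicit Types (J : {set 'I_s}) (m : {set 'I_s} -> M).

Let lt : rel 'I_s := fun i j => (i < j)%N.
Local Notation df := (delta lt f).

Lemma cochainP (b c : cochain M f) : (forall J, b J = c J) -> b = c.
Proof. by move=> e; apply/ffunP. Qed.

Definition cofrac a m : cochain M f := [ffun J : {set 'I_s} => Defs.frac (hp f J) (m J) a].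

Lemma cofracE a m J : cofrac a m J = Defs.frac (hp f J) (m J) a.
Proof. by rewrite ffunE. Qed.

Lemma cech_diff_cofrac a m : cech_diff (cofrac a m) = cofrac a (df a m).
Proof.
apply: cochainP => J; rewrite cofracE ffunE frac_sum; apply: eq_bigr => i iJ.
rewrite cofracE (@loc_mapE _ _ _ _ (f i)); last by rewrite /hp (big_setD1 i iJ).
rewrite frac_sign scalerA; congr (Defs.frac _ (_ ^+ _ * _ *: _) _).
by rewrite /cnt -sum1_card big_mkcondr.
Qed.

Lemma cofrac_tr a N m : cofrac (a + N) (tr f N m) = cofrac a m.
Proof. by apply: cochainP => J; rewrite !cofracE frac_scale. Qed.

Lemma eq_cofrac a m m' : cofrac a m = cofrac a m' ->
  exists N, forall J, tr f N m J = tr f N m' J.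
Proof.
move=> e; have /choice[c ce] J : exists c, hp f J ^+ (c + a) *: m J = hp f J ^+ (c + a) *: m' J.
  by apply/fracE; rewrite -!cofracE e.
pose C := (\max_J c J)%N; exists (C + a)%N => J; rewrite /tr.
have cC : (c J <= C)%N by exact: leq_bigmax.
by rewrite -(subnK cC) -addnA exprD -!scalerA ce.
Qed.

(** There are finitely many index sets, so the largest exponent serves as a common one; the free [n]
    lets it be raised further. *)
Lemma cochain_cofrac (P : {set 'I_s} -> nat -> M -> Prop) (z : cochain M f) :
  (forall J a n x, P J a x -> P J (a + n)%N (hp f J ^+ n *: x)) ->
  (forall J, exists a x, P J a x /\ z J = Defs.frac (hp f J) x a) ->
  exists A, forall n, exists m, (forall J, P J (A + n)%N (m J)) /\ z = cofrac (A + n) m.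
Proof.
move=> P_up Pz; have [a /choice[x ax]] := choice Pz.
pose A := (\max_J a J)%N; exists A => n.
have aA J : (a J <= A + n)%N by apply/leq_trans/leq_addr; exact: leq_bigmax.
exists (fun J => hp f J ^+ (A + n - a J) *: x J); split=> [J|].
  by rewrite -[X in P _ X _](subnKC (aA J)); apply: P_up; have [] := ax J.
apply: cochainP => J; have [_ ->] := ax J.
by rewrite cofracE -[X in Defs.frac _ (_ *: _) X](subnKC (aA J)) frac_scale.
Qed.

Lemma cochain_frac (z : cochain M f) :
  exists A, forall n, exists m, z = cofrac (A + n) m.
Proof.
have [//|J|A h] := @cochain_cofrac (fun _ _ _ => True) z.
  by elim/frac_ind: (z J) => x a; exists a, x.
by exists A => n; have [m [_ ?]] := h n; exists m.
Qed.

Lemma cochain_hom g (z : cochain M f) : (forall J, loc_comp M_ g (z J)) ->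
  exists a m, homog_on M_ d finset.setT a g m /\ z = cofrac a m.
Proof.
move=> hz; have [J a n x|J|A h] := @cochain_cofrac (fun J a => M_ (g + dp d J *+ a)) z.
- by move=> hx; rewrite mulrnDr addrA; apply: gr_compX => //; exact: R_hp.
- have [x [a [e [he hx zE]]]] := hz J.
  (* A nonzero [hp f J] has a unique degree, which forces [e = dp d J]. If it is zero, so is the
     localization, and the numerator [0] serves. *)
  have [p0|p0] := pselect (hp f J = 0); last first.
    by exists a, x; rewrite (R_uniq (R_hp R_1 R_M f_d J) he p0).
  exists 0%N, 0; split; first exact: gr_comp0.
  by rewrite zE; apply/fracE; exists 1%N; rewrite -/(hp f J) p0 !exprS !mul0r !scale0r.
by have [m [hm zE]] := h 0%N; exists (A + 0)%N, m; split=> // J _; exact: hm.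
Qed.

(** The differential raises the size of the index set by one. *)
Lemma delta_deg a m p J :
  df a (fun J => if #|J|.+1 == p then m J else 0) J = if #|J| == p then df a m J else 0.
Proof.
have e i : i \in J -> #|J :\ i|.+1 = #|J| by move=> iJ; rewrite [RHS](cardsD1 i) iJ.
case: ifP => Jp; first by apply: eq_bigr => i iJ; rewrite e ?Jp.
by rewrite /delta big1 // => i iJ; rewrite e ?Jp ?scaler0.
Qed.
(** [exact_at] treats all cohomological degrees at once. One way, a primitive is truncated to sets
    of size [p - 1]; the other way, [m] is cut into its pieces of each size and their primitives are
    added. *)
Lemma exact_cech g : exact_at M_ lt f d finset.setT g <->
  forall p (z : cocycle M f p), (forall J, loc_comp M_ g (cocycle_val z J)) ->
    z \in @coboundary R M s f p.
Proof.
split=> [ex p z hz | van a m hm dm].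
  have [a [m [hm zE]]] := cochain_hom hz.
  have /andP[/in_degreeP zp /eqP dz] : cocycle_val z \in @is_cocycle R M s f p by case: (z).
  (* The cocycle equation holds between fractions, hence between numerators only after a
     transition. *)
  have /eq_cofrac[N dN] : cofrac a (df a m) = cofrac a (fun=> 0).
    rewrite -cech_diff_cofrac -zE dz; apply: cochainP => J.
    by rewrite cofracE cochain0 frac0.
  have [||N' [b [_ eb]]] := ex (a + N)%N (tr f N m).
  - exact: homog_on_tr.
  - by move=> J _; rewrite delta_tr -/(tr f N (df a m) J) dN /tr scaler0.
  apply/asboolP; pose b' J := if #|J|.+1 == p then b J else 0.
  exists (cofrac (a + N + N') b'); split=> [J /negbTE nJ|].
    by rewrite cofracE /b' nJ frac0.
  apply: cochainP => J; rewrite cech_diff_cofrac cofracE delta_deg -eb ?finset.subsetT //.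
  case: eqP => [_|/eqP nJ]; last by rewrite frac0 zp.
  by rewrite -[RHS](cofracE _ (tr f N' (tr f N m))) !cofrac_tr -zE.
have hb p : exists b : cochain M f,
    cech_diff b = cofrac a (fun J => if #|J| == p then m J else 0).
  set y := cofrac _ _.
  have y_cocycle : y \in @is_cocycle R M s f p.
    apply/andP; split.
      by apply/in_degreeP=> J /negbTE nJ; rewrite cofracE nJ frac0.
    rewrite cech_diff_cofrac; apply/eqP/cochainP=> J; rewrite cofracE cochain0.
    rewrite (_ : df _ _ _ = 0) ?frac0 //.
    have -> : (fun J => if #|J| == p then m J else 0) =
      (fun J => if #|J|.+1 == p.+1 then m J else 0) by [].
    by rewrite delta_deg dm ?finset.subsetT //; case: ifP.
  have /asboolP[b [_ yb]] : Cocycle y_cocycle \in @coboundary R M s f p.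
    apply: van => J; exists (if #|J| == p then m J else 0), a, (dp d J); split.
    - exact: R_hp.
    - by case: ifP => _; [apply: hm; exact: finset.subsetT | exact: gr_comp0].
    - exact: cofracE.
  by exists b; rewrite -yb.
have [b bE] := choice hb.
(* The sizes of index sets run from [0] to [s]. *)
have [A hA] := cochain_frac (\sum_(p < s.+1) b p).
(* The offset [a] lets the numerators [m] and [n] meet at the exponent [a + A]. *)
have [n nE] := hA a; rewrite addnC in nE.
have /eq_cofrac[N e] : cofrac (a + A) (tr f A m) = cofrac (a + A) (df (a + A) n).
  rewrite -cech_diff_cofrac -nE raddf_sum cofrac_tr.
  apply: cochainP => J; rewrite cofracE.
  rewrite (big_morph (fun z : cochain M f => z J) (id1 := 0) (op1 := +%R)) /=; first last.
  - by rewrite cochain0.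
  - by move=> y z; rewrite ffunE.
  have Js : (#|J| < s.+1)%N by rewrite ltnS -[X in (_ <= X)%N](card_ord s) max_card.
  rewrite (bigD1 (Ordinal Js)) //= [X in _ = _ + X]big1 => [|p].
    by rewrite addr0 bE cofracE eqxx.
  by rewrite bE cofracE eq_sym -val_eqE /= eq_sym => /negbTE ->; rewrite frac0.
exists (A + N)%N; rewrite addnA.
apply: (@homog_on_primitive _ _ _ _ _ _ lt f d f_d _ _ _ _ (tr f N n)).
  by rewrite -addnA; exact: homog_on_tr.
by move=> J _; rewrite delta_tr -/(tr f N (df _ n) J) -e tr_tr addnC.
Qed.

End CechKoszul.

(** * Multigraded polynomial rings *)

Section Multigraded.
Variables (S : comNzRingType) (k : nat) (n : 'I_k -> nat).
Let Rx : comNzRingType := mring S n.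
Let R_ : Zk k -> set Rx := @mring_comp S k n.
Implicit Types (F : mhfamily S n) (e g : Zk k).

Lemma monom_mdeg0 : @monom_mdeg k n 0%MM = 0.
Proof. by apply/ffunP=> i; rewrite !ffunE big1 // => j _; rewrite mnm0E. Qed.

Lemma monom_mdegD m m' :
  @monom_mdeg k n (m + m')%MM = monom_mdeg m + monom_mdeg m'.
Proof.
apply/ffunP=> i; rewrite !ffunE -big_split; apply: eq_bigr => j _.
by rewrite mnmDE PoszD.
Qed.

Lemma mring_comp_1 : R_ 0 1.
Proof. by move=> m; rewrite msupp1 inE => /eqP ->; exact: monom_mdeg0. Qed.

Lemma mring_comp_M e e' (u v : Rx) : R_ e u -> R_ e' v -> R_ (e + e') (u * v).
Proof.
move=> hu hv m /msuppM_le /allpairsP[[p q] [pu qv ->]] /=.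
by rewrite monom_mdegD hu ?hv.
Qed.

Lemma mring_comp_uniq e e' (u : Rx) : R_ e u -> R_ e' u -> u <> 0 -> e = e'.
Proof.
move=> hu hu' /eqP; rewrite -msupp_eq0; case us: (msupp u) => [//|m t] _.
have mu : m \in msupp u by rewrite us mem_head.
by rewrite -(hu m mu) -(hu' m mu).
Qed.

Definition nonneg_deg e := exists mu : {ffun 'I_k -> nat}, e = [ffun i => (mu i)%:Z].

Definition above (gamma g : Zk k) := exists mu : {ffun 'I_k -> nat},
  g = gamma + [ffun i => (mu i)%:Z].

Lemma aboveD gamma g e : nonneg_deg e -> above gamma g -> above gamma (g + e).
Proof.
move=> [nu ->] [mu ->]; exists [ffun i => (mu i + nu i)%N].
by apply/ffunP=> i; rewrite !ffunE PoszD addrA.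
Qed.

Lemma hfamily_degrees F : exists d : 'I_(hf_size F) -> Zk k,
  forall j, R_ (d j) (F j) /\ nonneg_deg (d j).
Proof.
suff /choice[d dP] : forall j, exists e, R_ e (F j) /\ nonneg_deg e by exists d.
case: F => s f hf /= j; have [e he] := hf j.
case us: (msupp (f j)) => [|m t].
  (* The zero polynomial is homogeneous of every degree; [0] is a choice inside N^k. *)
  exists 0; split=> [m|]; first by rewrite us in_nil.
  by exists [ffun=> 0%N]; apply/ffunP=> i; rewrite !ffunE.
have mu : m \in msupp (f j) by rewrite us mem_head.
exists e; split=> //; rewrite -(he m mu).
exists [ffun i => (\sum_(j < n i) m (var_rank j))%N]; apply/ffunP=> i.
by rewrite !ffunE; exact/esym/(big_morph Posz PoszD).
Qed.

Variables (M : lmodType Rx) (M_ : mgraded_module M).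

Lemma csuppPn F (d : 'I_(hf_size F) -> Zk k) g : (forall j, R_ (d j) (F j)) ->
  ~ csupp M_ F g <-> exact_at M_ (fun i j : 'I_(hf_size F) => (i < j)%N) F d [set: _]%SET g.
Proof.
move=> hd.
have ->  := @exact_cech _ _ _ mring_comp_1 mring_comp_M mring_comp_uniq M M_ _ F d hd g.
split=> [ng p z hz|van [p [_ [[z [hz ->]]]]]].
  rewrite -quot_pi_eq0; apply/eqP; apply: contrapT => nz; apply: ng.
  by exists p, (\pi z); split=> //; exists z.
by apply; apply/eqP; rewrite quot_pi_eq0; exact: van.
Qed.

Lemma star_csuppPn F (d : 'I_(hf_size F) -> Zk k) gamma : (forall j, R_ (d j) (F j)) ->
  ~ star (csupp M_ F) gamma <->
  exact_on M_ (above gamma) (fun i j : 'I_(hf_size F) => (i < j)%N) F d [set: _]%SET.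
Proof.
move=> hd; split=> [ng g [mu gE]|ex [e [mu [Fe gE]]]].
  apply/(csuppPn _ hd) => Fg; apply: ng; exists g, mu; split=> //.
  by rewrite gE addrK.
by move: Fe; apply/(csuppPn _ hd)/ex; exists mu; rewrite gE subrK.
Qed.

Lemma ideal_gen_hfamily F j : ideal_gen F (F j).
Proof.
exists (fun i => (i == j)%:R); rewrite (bigD1 j) //= eqxx mul1r big1 ?addr0 //.
by move=> i /negbTE ->; rewrite mul0r.
Qed.

Lemma star_csupp_le F F' : (ideal_gen F `<=` ideal_gen F')%classic ->
  (star (csupp M_ F') `<=` star (csupp M_ F))%classic.
Proof.
move=> FF' gamma; apply: contraPP.
have [d dP] := hfamily_degrees F; have [d' dP'] := hfamily_degrees F'.
have hd j : R_ (d j) (F j) by case: (dP j).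
have hd' j : R_ (d' j) (F' j) by case: (dP' j).
move=> /(star_csuppPn _ hd) ex; apply/(star_csuppPn _ hd').
apply: (exact_on_ideal_le mring_comp_1 mring_comp_M) ex => //.
- exact: tournament_ltn.
- exact: tournament_ltn.
- by move=> g j; apply: aboveD; case: (dP j).
- by move=> g j; apply: aboveD; case: (dP' j).
- by move=> i; apply/FF'/ideal_gen_hfamily.
Qed.

(** By contraposition: exactness for every [FB x] passes to the family of all products, and from
    there to [F], whose ideal contains them. *)
Lemma star_csupp_products (K : finType) (FB : K -> mhfamily S n) F :
  (forall c : {dffun forall x, 'I_(hf_size (FB x))},
     ideal_gen F (\prod_x FB x (c x))) ->
  (star (csupp M_ F) `<=` \bigcup_x star (csupp M_ (FB x)))%classic.
Proof.
move=> FP gamma; apply: contraPP => nB; have [d dP] := hfamily_degrees F.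
have hd j : R_ (d j) (F j) by case: (dP j).
apply/(star_csuppPn _ hd).
pose e x := sval (cid (hfamily_degrees (FB x))).
have eP x j : R_ (e x j) (FB x j) /\ nonneg_deg (e x j) by rewrite /e; case: cid.
have he x j : R_ (e x j) (FB x j) by case: (eP x j).
have De x j g : above gamma g -> above gamma (g + e x j).
  by apply: aboveD; case: (eP x j).
have ex : exact_on M_ (above gamma) (rank_rel {dffun forall x, 'I_(hf_size (FB x))})
    (fun c => \prod_x FB x (c x)) (fun c => \sum_x e x (c x)) [set: _]%SET.
  apply: (@exact_on_products _ _ _ mring_comp_1 mring_comp_M M M_ (above gamma) K
    (fun x => 'I_(hf_size (FB x))) (fun x i j => (i < j)%N) (fun x => FB x) e) => //.
  - by move=> x; exact: tournament_ltn.
  - move=> x; apply/(star_csuppPn _ (he x)) => Fx; apply: nB; by exists x.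
apply: (exact_on_ideal_le mring_comp_1 mring_comp_M) ex => //.
- exact: tournament_rank.
- exact: tournament_ltn.
- by move=> c; elim/big_ind2: _ => //; [exact: mring_comp_1 | move=> ? ? ? ?; exact: mring_comp_M].
- move=> g c; elim/big_ind: _ g => [g|u v hu hv g Dg|x _ g]; rewrite ?addr0 //; last exact: De.
  by rewrite addrA; apply/hv/hu.
- by move=> g j; apply: aboveD; case: (dP j).
Qed.

End Multigraded.

(** * Equality of the three unions *)

Local Open Scope classical_set_scope.

Theorem theorem1p1 (S : comNzRingType) (k : nat) (n : 'I_k -> nat)
  (hk : (1 <= k)%N) (hn : forall i, (1 <= n i)%N)
  (M : lmodType (mring S n)) (M_ : mgraded_module M)
  (FB : 'I_k -> mhfamily S n) (Fsum : {set 'I_k} -> mhfamily S n)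
  (Fcap : mhfamily S n)
  (hFB : forall i, ideal_gen (FB i) = block_ideal S n i)
  (hFsum : forall P : {set 'I_k},
     P != finset.set0 -> ideal_gen (Fsum P) = block_sum S n P)
  (hFcap : ideal_gen Fcap = block_cap S n) :
  \bigcup_i star (csupp M_ (FB i)) =
    \bigcup_(P in [set P : {set 'I_k} | P != finset.set0])
       star (csupp M_ (Fsum P)) /\
  \bigcup_(P in [set P : {set 'I_k} | P != finset.set0])
       star (csupp M_ (Fsum P)) =
    star (csupp M_ Fcap).
Proof.
have BP i (P : {set 'I_k}) : i \in P -> block_ideal S n i `<=` block_sum S n P.
  move=> iP r hr; exists (fun j => if j == i then r else 0); split=> [j _|].
    case: eqP => [->//|_]; exists (fun=> 0).
    by rewrite big1 // => l _; rewrite mul0r.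
  rewrite (bigD1 i iP) /= eqxx big1 ?addr0 // => j /andP[_ /negbTE ->].
  by [].
have PB i : block_sum S n [set i]%SET `<=` block_ideal S n i.
  by move=> _ [b [hb ->]]; rewrite big_set1; apply: hb; rewrite finset.set11.
have LP : \bigcup_i star (csupp M_ (FB i)) =
    \bigcup_(P in [set P : {set 'I_k} | P != finset.set0]) star (csupp M_ (Fsum P)).
  apply/seteqP; split=> [g [i _ Fg]|g [P P0 Pg]].
    have i0 : [set i]%SET != finset.set0 by rewrite -card_gt0 cards1.
    exists [set i]%SET => //; apply: star_csupp_le Fg.
    by rewrite hFsum // hFB.
  (* A larger ideal has a smaller star, so any block in [P] bounds the star of the sum. *)
  have [i iP] := set0Pn _ P0; exists i => //; apply: star_csupp_le Pg.
  by rewrite hFsum // hFB; exact: BP.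
split=> //; rewrite -LP; apply/seteqP; split=> [g [i _]|].
  by apply: star_csupp_le; rewrite hFB hFcap => r; apply.
(* A product of one generator from each block is a multiple of its [i]-th factor for every [i],
   hence lies in the intersection. *)
apply: star_csupp_products => c; rewrite hFcap => i _; rewrite -hFB.
rewrite (bigD1 i) //= mulrC; have [a ->] := ideal_gen_hfamily (c i).
exists (fun j => (\prod_(x | x != i) FB x (c x)) * a j); rewrite mulr_sumr.
by apply: eq_bigr => j _; rewrite mulrA.
Qed.
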